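(* For every finite simple graph $G$, $\chi_2(G)-\chi(G)\le \alpha'(G)+3$.
   Context: $\chi(G)$ is the chromatic number of $G$ and $\alpha'(G)$ is the matching number (maximum size of a matching) of $G$. A dynamic coloring of $G$ is a proper vertex coloring such that for every vertex $v$ of degree at least $2$, the neighbours of $v$ receive at least two different colors; $\chi_2(G)$ is the smallest number of colors in a dynamic coloring of $G$. *)

(* Defs.v *)
From mathcomp Require Import all_boot.

Set Implicit Arguments.
Unset Strict Implicit.
Unset Printing Implicit Defensive.

Record sgraph := SGraph {
  vertex :> finType;
  adj : rel vertex;
  adj_sym : symmetric adj;
  adj_irr : irreflexive adj }.

Section GraphParameters.

Variable G : sgraph.

Definition neighbours (v : G) : {set G} := [set w | adj v w].

Definition degree (v : G) : nat := #|neighbours v|.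

Definition proper_coloring k (c : {ffun G -> 'I_k}) : bool :=
  [forall x, forall y, adj x y ==> (c x != c y)].

Definition dynamic_coloring k (c : {ffun G -> 'I_k}) : bool :=
  proper_coloring c &&
  [forall v, (2 <= degree v) ==> (2 <= #|[set c w | w in neighbours v]|)].

Definition colorable k : bool :=
  [exists c : {ffun G -> 'I_k}, proper_coloring c].

Definition dynamic_colorable k : bool :=
  [exists c : {ffun G -> 'I_k}, dynamic_coloring c].

(* Giving all vertices different colors is always a dynamic coloring. *)
Lemma dynamic_colorable_ex : exists k, dynamic_colorable k.
Proof.
exists #|G|; apply/existsP; exists [ffun x => enum_rank x]; apply/andP; split.
  apply/forallP=> x; apply/forallP=> y; apply/implyP=> exy.
  rewrite !ffunE (inj_eq enum_rank_inj).
  by apply: contraTneq exy => ->; rewrite adj_irr.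
apply/forallP=> v; apply/implyP=> dv; rewrite card_imset //.
by move=> x y; rewrite !ffunE; apply: enum_rank_inj.
Qed.

Lemma colorable_ex : exists k, colorable k.
Proof.
have [k /existsP[c /andP[cP _]]] := dynamic_colorable_ex.
by exists k; apply/existsP; exists c.
Qed.

Definition chromatic_number : nat := ex_minn colorable_ex.

Definition dynamic_chromatic_number : nat := ex_minn dynamic_colorable_ex.

Definition edges : {set {set G}} :=
  [set [set p.1; p.2] | p : G * G & adj p.1 p.2].

Definition matching (M : {set {set G}}) : bool :=
  (M \subset edges) && trivIset M.

Definition matching_number : nat :=
  \max_(M : {set {set G}} | matching M) #|M|.

End GraphParameters.

(* Main.v *)
(** A maximum matching is encoded as an involution [t] fixing exactly the
    uncovered vertices.  From every matching edge choose one endpoint; let [S]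
    be the set of chosen endpoints.  The vertices of [S] get pairwise distinct
    new colors, the uncovered vertices (an independent set) share one new color,
    and the other vertices keep the colors of an optimal proper coloring.  Any
    vertex of degree at least 2 with a neighbour in [S] then sees two colors.
    Choosing the endpoint with uncovered neighbours when only one has them, an
    uncovered vertex adjacent to [t s] is adjacent to [s], since otherwise there
    is an augmenting path.  The only vertices in trouble are the [s] in [S]
    without neighbours in [S] and without uncovered neighbours.  If [S] spans as
    many edges as possible, the matching edges at these [s] form an induced
    matching, so their partners can share one more new color, which repairs
    them.  In all this uses [chi + alpha' + 2] colors. *)

Require Import Defs.
From mathcomp Require Import all_boot.

Set Implicit Arguments.
Unset Strict Implicit.
Unset Printing Implicit Defensive.

Section DynamicColoring.

Variable G : sgraph.
Implicit Types (t : {ffun G -> G}) (S D : {set G}).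

Lemma dynamic_colorable_fun (K : finType) (f : G -> K) :
    (forall x y, adj x y -> f x != f y) ->
    (forall v, 2 <= degree v ->
       exists w1 w2, [/\ adj v w1, adj v w2 & f w1 != f w2]) ->
  dynamic_colorable G #|K|.
Proof.
move=> proper_f dyn_f.
apply/existsP; exists [ffun x => enum_rank (f x)]; apply/andP; split.
  apply/forallP=> x; apply/forallP=> y; apply/implyP=> /proper_f.
  by rewrite !ffunE (inj_eq enum_rank_inj).
apply/forallP=> v; apply/implyP=> /dyn_f[w1 [w2 [vw1 vw2 neq]]].
apply/card_gt1P; exists (enum_rank (f w1)), (enum_rank (f w2)).
by split; rewrite ?(inj_eq enum_rank_inj) //; apply/imsetP;
  [exists w1 | exists w2]; rewrite ?inE ?ffunE.
Qed.

Lemma other_neighbour (v w : G) :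
  2 <= degree v -> exists2 w', adj v w' & w' != w.
Proof.
move=> /card_gt1P[w1 [w2 [+ + neq]]]; rewrite !inE => vw1 vw2.
by have [eq1|] := eqVneq w1 w; [exists w2; rewrite // -eq1 eq_sym | exists w1].
Qed.

(** * Maximum matchings as involutions, and augmentation *)

Definition mating t :=
  [forall x, (t (t x) == x) && ((t x != x) ==> adj x (t x))].

Lemma matingK t : mating t -> involutive t.
Proof. by move=> /forallP tP x; have /andP[/eqP] := tP x. Qed.

Lemma mating_adj t x : mating t -> t x != x -> adj x (t x).
Proof. by move=> /forallP tP; have /andP[_ /implyP] := tP x. Qed.

Definition uncovered t : {set G} := [set x | t x == x].

Definition max_mating t :=
  mating t /\ forall t', mating t' -> #|uncovered t| <= #|uncovered t'|.

Lemma max_mating_ex : exists t, max_mating t.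
Proof.
have id_mating : mating [ffun x => x].
  by apply/forallP=> x; rewrite !ffunE !eqxx.
case: (arg_minnP (fun t => #|uncovered t|) id_mating) => t tP t_min.
by exists t; split.
Qed.

(** Edge exchange: former partners of [x] and [y] become uncovered, so the result is again a
    matching. *)
Definition link t (x y : G) : {ffun G -> G} :=
  [ffun z => if z == x then y else if z == y then x
             else if (t z == x) || (t z == y) then z else t z].

Lemma link_mating t x y : mating t -> adj x y -> mating (link t x y).
Proof.
move=> tP xy; have tK := matingK tP.
have neq_xy : x == y = false by apply: contraTF xy => /eqP->; rewrite adj_irr.
apply/forallP=> z; rewrite !ffunE.
have neq_yx : y == x = false by rewrite eq_sym.
have [->|zx] := eqVneq z x; first by rewrite neq_yx !eqxx xy implybT.
have [->|zy] := eqVneq z y.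
  by rewrite !eqxx adj_sym xy implybT.
have [tz|] := boolP ((t z == x) || (t z == y)).
  by rewrite (negPf zx) (negPf zy) tz eqxx.
rewrite negb_or => /andP[/negPf-> /negPf->].
rewrite tK (negPf zx) (negPf zy) eqxx /=.
by apply/implyP; apply: mating_adj.
Qed.

(** An edge between two uncovered vertices could be added to the matching. *)
Lemma uncovered_nadj t x y :
  max_mating t -> x \in uncovered t -> y \in uncovered t -> ~~ adj x y.
Proof.
move=> [tP t_min]; rewrite !inE => /eqP tx /eqP ty; apply/negP => xy.
have := t_min _ (link_mating tP xy); rewrite leqNgt => /negP[].
have tK := matingK tP.
apply/proper_card/properP; split; last first.
  exists x; rewrite inE ?tx // ffunE eqxx.
  by apply: contraTneq xy => ->; rewrite adj_irr.
apply/subsetP=> z; rewrite !inE ffunE.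
have [->|_] := eqVneq z x; first by rewrite tx eqxx.
have [->|_] := eqVneq z y; first by rewrite ty eqxx.
case: ifP => // /orP[] /eqP tz _; rewrite -{2}(tK z) tz ?tx ?ty //.
Qed.

(** The augmenting path is handled by one exchange: [link t x (t s)] is still maximum and uncovers
    [s] in place of [x]. If [y] differed from [x], it would stay uncovered and the edge from [y] to
    [s] would contradict [uncovered_nadj]. *)
Lemma uncovered_common t (x y s : G) : max_mating t ->
    x \in uncovered t -> y \in uncovered t -> t s != s ->
    adj x (t s) -> adj y s ->
  x = y.
Proof.
move=> tM xX yX ts xts ys; have [tP t_min] := tM; have tK := matingK tP.
move: (xX) (yX); rewrite !inE => /eqP tx /eqP ty.
apply/eqP/negPn/negP => neq_xy.
have sx : s != x by apply: contraNneq ts => ->; rewrite tx.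
have tsx : t s != x by rewrite -tx (inj_eq (inv_inj tK)).
have tsy : t s != y.
  by apply: contraNneq ts => e; rewrite -{2}(tK s) e ty.
have eqU : uncovered (link t x (t s)) = s |: (uncovered t :\ x).
  apply/setP=> z; rewrite !inE ffunE.
  have [->|zx] := eqVneq z x.
    by rewrite (negPf tsx) eq_sym (negPf sx).
  have [->|zts] := eqVneq z (t s).
    by rewrite tK [x == _]eq_sym [s == _]eq_sym (negPf tsx) (negPf ts).
  rewrite (inj_eq (inv_inj tK)) -{1}tx (inj_eq (inv_inj tK)) (negPf zx) /=.
  by have [->|] := eqVneq z s; rewrite ?eqxx.
have t'M : max_mating (link t x (t s)).
  split; first exact: link_mating.
  move=> t' /t_min; apply: leq_trans.
  by rewrite eqU cardsU1 (cardsD1 x (uncovered t)) xX leq_add2r leq_b1.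
have := uncovered_nadj t'M (x := y) (y := s).
rewrite eqU !inE ty !eqxx [y == x]eq_sym neq_xy orbT ys.
by move=> /(_ isT isT).
Qed.

(** * Choosing one endpoint of each matching edge *)

Definition transversal_of t S :=
  [forall x, (x \in S) == (t x != x) && (t x \notin S)].

Lemma transversalE t S x : transversal_of t S ->
  (x \in S) = (t x != x) && (t x \notin S).
Proof. by move=> /forallP/(_ x)/eqP. Qed.

Lemma transversal_matching t S :
  mating t -> transversal_of t S -> #|S| <= matching_number G.
Proof.
move=> tP SP; have tK := matingK tP.
have SN x : x \in S -> t x \notin S.
  by rewrite (transversalE _ SP) => /andP[].
have eqS x y z : x \in S -> y \in S ->
    z \in [set x; t x] -> z \in [set y; t y] -> x = y.
  move=> xS yS; rewrite !inE => /orP[]/eqP-> /orP[]/eqP//.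
  - by move=> xty; have := SN _ yS; rewrite -xty xS.
  - by move=> txy; have := SN _ xS; rewrite txy yS.
  by move/(inv_inj tK).
pose M := [set [set x; t x] | x in S].
have <- : #|M| = #|S|.
  apply: card_in_imset => x y xS yS eqxy.
  by apply: (eqS _ _ x) => //; rewrite -?eqxy !inE eqxx.
apply: (@leq_bigmax_cond _ (@matching G) (fun M => #|M|)).
apply/andP; split.
  apply/subsetP=> _ /imsetP[x xS ->]; apply/imsetP; exists (x, t x) => //.
  rewrite inE; apply: mating_adj => //.
  by move: xS; rewrite (transversalE _ SP) => /andP[].
apply/trivIsetP=> _ _ /imsetP[x xS ->] /imsetP[y yS ->] neq.
apply/pred0P=> z /=; apply: contraNF neq => /andP[zx zy].
by rewrite (eqS x y z).
Qed.

Definition sees_uncovered t (x : G) := [exists y in uncovered t, adj x y].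

Definition good_transversal t S := transversal_of t S &&
  [forall x in S, sees_uncovered t (t x) ==> sees_uncovered t x].

Lemma good_transversal_ex t : mating t -> exists S, good_transversal t S.
Proof.
move=> tP; have tK := matingK tP.
pose h := sees_uncovered t.
(* Ranks break the tie when both endpoints or neither see an uncovered vertex. *)
pose S := [set x | (t x != x) &&
  (if h x == h (t x) then enum_rank x < enum_rank (t x) else h x)].
exists S; apply/andP; split.
  apply/forallP=> x; rewrite !inE tK [x == _]eq_sym [h (t x) == _]eq_sym.
  have [//|neq /=] := eqVneq (t x) x.
  case: ifP => [_|]; last by case: (h x); case: (h (t x)).
  rewrite -leqNgt ltn_neqAle (inj_eq val_inj) (inj_eq enum_rank_inj).
  by rewrite [x == _]eq_sym neq.
apply/forall_inP=> x; rewrite inE => /andP[_].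
by rewrite -/h; case: (h x); case: (h (t x)).
Qed.

(** Ordered pairs count every edge inside [S] twice, which does not affect maximality. *)
Definition inner_arcs S : {set G * G} :=
  [set p | [&& p.1 \in S, p.2 \in S & adj p.1 p.2]].

Definition best_transversal t S := good_transversal t S /\
  forall S', good_transversal t S' -> #|inner_arcs S'| <= #|inner_arcs S|.

Lemma best_transversal_ex t : mating t -> exists S, best_transversal t S.
Proof.
move=> /good_transversal_ex[S0 S0P].
case: (arg_maxnP (fun S => #|inner_arcs S|) S0P) => S SP S_max.
by exists S; split.
Qed.

Definition lonely t S : {set G} :=
  [set x in S | ~~ sees_uncovered t x & [forall y in S, ~~ adj x y]].

Definition flip t S D : {set G} := S :\: D :|: [set x | t x \in D].

(** The partner of a newly chosen endpoint is lonely, hence sees no uncovered vertex, and the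
    goodness condition there is vacuous. *)
Lemma flip_good t S D : mating t -> good_transversal t S ->
  D \subset lonely t S -> good_transversal t (flip t S D).
Proof.
move=> tP /andP[SP /forall_inP Sh] /subsetP DL; have tK := matingK tP.
have DS x : x \in D -> x \in S by move=> /DL; rewrite inE => /andP[].
apply/andP; split.
  apply/forallP=> x; rewrite !inE tK.
  have := transversalE x SP; have := DS x; have := DS (t x).
  have [-> | _] := eqVneq (t x) x; last first.
    by case: (x \in S); case: (x \in D); case: (t x \in S);
       case: (t x \in D) => //= H1 H2 //; by [have := H1 isT | have := H2 isT].
  by move=> _ xDS xS; move: xDS; rewrite xS; case: (x \in D) => // /(_ isT).
apply/forall_inP=> x; rewrite !inE => /orP[/andP[_ /Sh]//|/DL].
by rewrite inE => /and3P[_ /negPf->].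
Qed.

(** Lonely vertices have no neighbour in [S], so a flip loses no inner arc. By maximality it gains
    none either. *)
Lemma best_flip t S D x y : mating t -> best_transversal t S ->
    D \subset lonely t S -> x \in flip t S D -> y \in flip t S D ->
  adj x y -> x \in S.
Proof.
move=> tP [SP S_max] DL xF yF xy.
have := S_max _ (flip_good tP SP DL); apply: contraTT => xS.
rewrite -ltnNge; apply/proper_card/properP; split; last first.
  by exists (x, y); rewrite inE /= ?(negPf xS) // xF yF.
have SD u v : u \in S -> v \in S -> adj u v -> u \in flip t S D.
  move=> uS vS uv; rewrite !inE uS andbT; apply/orP; left.
  apply: contraL uv => /(subsetP DL); rewrite inE => /and3P[_ _ /forall_inP].
  exact.
apply/subsetP=> -[u v]; rewrite inE /= => /and3P[uS vS uv].
by rewrite inE /= (SD u v) // (SD v u) // adj_sym.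
Qed.

(** Flipping [u] alone brings in [t u] and keeps any other [v], so their edge would be a new inner
    arc. *)
Lemma lonely_partner_chosen t S u v : mating t -> best_transversal t S ->
  u \in lonely t S -> v \in S -> adj (t u) v -> v = u.
Proof.
move=> tP SM uL vS tuv; have tK := matingK tP.
have uS : u \in S by move: uL; rewrite inE => /andP[].
apply/eqP/negPn/negP => neq.
suff: t u \in S.
  by move: uS; rewrite (transversalE _ (proj1 (andP SM.1))) => /andP[_ /negPf->].
apply: (best_flip tP SM (D := [set u])) tuv; rewrite ?sub1set // !inE.
  by rewrite tK eqxx orbT.
by rewrite neq vS.
Qed.

Lemma lonely_partners_nadj t S u v : mating t -> best_transversal t S ->
  u \in lonely t S -> v \in lonely t S -> ~~ adj (t u) (t v).
Proof.
move=> tP SM uL vL; have tK := matingK tP; apply/negP=> tuv.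
have uS : u \in S by move: uL; rewrite inE => /andP[].
suff: t u \in S.
  by move: uS; rewrite (transversalE _ (proj1 (andP SM.1))) => /andP[_ /negPf->].
apply: (best_flip tP SM (D := [set u; v])) tuv.
- by apply/subsetP=> w /set2P[]->.
- by rewrite !inE tK eqxx !orbT.
by rewrite !inE tK eqxx !orbT.
Qed.

(** * The new coloring *)

(** The two [option] layers supply the two shared colors and [inr] the private ones, so the palette
    has [k + #|S| + 2] colors. *)
Definition recolor k (c : G -> 'I_k) t S (x : G) :
    option (option ('I_k + {y | y \in S})) :=
  if insub x is Some y then Some (Some (inr y))
  else if x \in uncovered t then None
  else if t x \in lonely t S then Some None
  else Some (Some (inl (c x))).

Lemma recolor_chosen k (c : G -> 'I_k) t S x y :
  x \in S -> recolor c t S x = recolor c t S y -> x = y.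
Proof.
rewrite /recolor => xS; rewrite insubT.
case: insubP => [u uS <- [<-]//|_]; by do 2!case: ifP => // _.
Qed.

Lemma recolorN k (c : G -> 'I_k) t S x : x \notin S ->
  recolor c t S x = if x \in uncovered t then None
    else if t x \in lonely t S then Some None else Some (Some (inl (c x))).
Proof. by move=> xS; rewrite /recolor insubN. Qed.

(** Private colors never clash, and both shared color classes are independent sets. *)
Lemma recolor_proper k (c : {ffun G -> 'I_k}) t S x y :
    proper_coloring c -> max_mating t -> best_transversal t S -> adj x y ->
  recolor c t S x != recolor c t S y.
Proof.
move=> /forallP cP tM SM xy; have tP := tM.1; have tK := matingK tP.
have neq : x != y by apply: contraTneq xy => ->; rewrite adj_irr.
have [xS|xS] := boolP (x \in S).
  by apply: contra neq => /eqP/(recolor_chosen xS)->.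
have [yS|yS] := boolP (y \in S).
  by apply: contra neq => /eqP/esym/(recolor_chosen yS)->.
rewrite !recolorN //.
have [xX|xX] := boolP (x \in uncovered t).
  have [yX|_] := boolP (y \in uncovered t); last by case: ifP.
  by have := uncovered_nadj tM xX yX; rewrite xy.
have [yX|yX] := boolP (y \in uncovered t); first by case: ifP.
have [xL|xL] := boolP (t x \in lonely t S);
  have [yL|yL] := boolP (t y \in lonely t S) => //.
  by have := lonely_partners_nadj tP SM xL yL; rewrite !tK xy.
have /forallP/(_ y) := cP x; rewrite xy /=; apply: contra => /eqP[->].
exact: eqxx.
Qed.

Lemma recolor_dynamic k (c : G -> 'I_k) t S v :
    max_mating t -> best_transversal t S -> 2 <= degree v ->
  exists w1 w2, [/\ adj v w1, adj v w2 &
    recolor c t S w1 != recolor c t S w2].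
Proof.
move=> tM SM dv; have tP := tM.1; have tK := matingK tP.
have [/andP[SP /forall_inP Sh] _] := SM.
have chosen s : s \in S -> adj v s -> exists w1 w2, [/\ adj v w1, adj v w2 &
    recolor c t S w1 != recolor c t S w2].
  move=> sS vs; have [w vw ws] := other_neighbour s dv.
  exists s, w; split=> //.
  by apply: contra ws => /eqP/(recolor_chosen sS)->.
have partner w : t w != w -> w \notin S -> t w \in S.
  by move=> tw wS; rewrite (transversalE _ SP) tK eq_sym tw.
have [vS|vS] := boolP (v \in S); last first.
  have [vX|vX] := boolP (v \in uncovered t); last first.
    rewrite inE in vX; exact: chosen (partner _ vX vS) (mating_adj tP vX).
  (* For uncovered [v], a neighbour [w] outside [S] has its partner in [S]. By goodness [t w] sees
     some uncovered [y], and [uncovered_common] gives [y = v], so [v] is adjacent to [t w]. *)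
  have [w vw _] := other_neighbour v dv.
  have [wS|wS] := boolP (w \in S); first exact: chosen vw.
  have tw : t w != w.
    by apply/negP=> wX; have := uncovered_nadj tM vX (y := w);
      rewrite inE wX vw => /(_ isT).
  have twS := partner _ tw wS.
  apply: (chosen _ twS).
  have /Sh/implyP := twS; rewrite tK => /(_ _)/exists_inP[].
    by apply/exists_inP; exists v; rewrite // adj_sym.
  move=> y yX twy.
  rewrite (uncovered_common tM vX yX (s := t w)) ?tK 1?eq_sym //.
    by rewrite adj_sym.
  by rewrite adj_sym.
have := vS; rewrite (transversalE _ SP) => /andP[tv tvS].
have vtv := mating_adj tP tv.
have tvX : t v \notin uncovered t by rewrite inE tK eq_sym.
have [/exists_inP[x xX vx]|vNX] := boolP (sees_uncovered t v).
  exists x, (t v); split=> //.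
  have xS : x \notin S by move: xX; rewrite (transversalE _ SP) inE => ->.
  by rewrite !recolorN // xX (negPf tvX); case: ifP.
have [/exists_inP[s sS vs]|vNS] := boolP [exists s in S, adj v s].
  exact: chosen vs.
(* Here [t v] has the color [Some None]. Another neighbour [w] of [v] with this color would have a
   lonely partner, and [lonely_partner_chosen] would force [w = t v]. *)
have vL : v \in lonely t S.
  by rewrite inE vS vNX; rewrite negb_exists_in in vNS.
have [w vw wtv] := other_neighbour (t v) dv.
exists (t v), w; split=> //.
have wS : w \notin S.
  by apply: contra vNS => wS; apply/exists_inP; exists w.
have wX : w \notin uncovered t.
  by apply: contra vNX => wX; apply/exists_inP; exists w.
rewrite !recolorN // (negPf tvX) (negPf wX) tK vL.
case: ifP => // twL; have := lonely_partner_chosen tP SM twL vS.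
by rewrite tK adj_sym vw => /(_ isT) e; rewrite e tK eqxx in wtv.
Qed.

End DynamicColoring.

Theorem theorem8 (G : sgraph) :
  dynamic_chromatic_number G - chromatic_number G <= matching_number G + 3.
Proof.
have [t tM] := max_mating_ex G.
have [S SM] := best_transversal_ex tM.1.
have Sm := transversal_matching tM.1 (proj1 (andP SM.1)).
rewrite leq_subLR /chromatic_number; case: ex_minnP => k /existsP[c cP] _.
have dynK := dynamic_colorable_fun
  (fun x y => recolor_proper cP tM SM (x := x) (y := y))
  (fun v => recolor_dynamic c tM SM (v := v)).
rewrite /dynamic_chromatic_number; case: ex_minnP => l _ /(_ _ dynK) ll.
(* Only [#|S| + 2] colors are added to [k], so at least one color is to spare. *)
apply: leq_trans ll _; rewrite !card_option card_sum card_ord card_sig.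
by rewrite -!addnS leq_add2l addn3 !ltnS leqW.
Qed.
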